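(* Let $d,q$ be positive integers, and for each $j\in\{1,\ldots,d\}$ let $U_j$ be a ground walk in the $j$th coordinate of the Hamming graph $H(d,q)$. Then for each $i\in\{1,\ldots,d\}$, the walk $U_i$ is not equivalent to any product (concatenation) of the walks $U_j$ with $j\neq i$ and their inverses; that is, in $\Pi(H(d,q))$ the class of $U_i$ is not in the subgroup generated by the classes of the $U_j$, $j\neq i$.
   Context: The Hamming graph $H(d,q)$ has vertex set $\{(x_1,\ldots,x_d): x_i\in S\}$ with $S=\{0,1,\ldots,q-1\}$, and two vertices are adjacent if and only if they differ in exactly one coordinate; $\mathbf{0}=(0,\ldots,0)$. A walk of length $n$ in a graph is a sequence of vertices $(v_0v_1\cdots v_n)$ with $v_i$ adjacent to $v_{i+1}$ for all $0\le i<n$. A ground walk in the $i$th coordinate is a closed walk of length three $U_i=(\mathbf{0}\,(0,\ldots,a_i,\ldots,0)\,(0,\ldots,b_i,\ldots,0)\,\mathbf{0})$, where $a_i,b_i$ are placed in the $i$th coordinate and all other coordinates are $0$ (so $a_i,b_i$ are nonzero and distinct). The inverse of a walk is the same walk traversed in reverse. Two walks are equivalent, written $\simeq$ (homotopic rel endpoints for $\times$-homotopy), if one can be transformed into the other by a finite sequence of the following moves: (1) spider moves: replacing a single interior vertex $v_k$ ($0<k<n$) of a walk by another vertex $v_k'$ such that the result is again a walk (so $v_k'$ is adjacent to both $v_{k-1}$ and $v_{k+1}$); (2) prunes: if $v_i=v_{i+2}$, deleting the entries $v_i,v_{i+1}$ from the walk; (3) anti-prunes: the inverse operation of a prune. For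 a connected graph $G$ and a vertex $v$ of $G$, the fundamental group $\Pi(G)$ is the set of equivalence classes of closed walks starting and ending at $v$, with concatenation as operation; for Hamming graphs the base vertex is $\mathbf{0}$. *)

(* Defs.v *)
From Stdlib Require Import Relation_Operators.
From HB Require Import structures.
From mathcomp Require Import all_boot.
From mathcomp Require Import boolp classical_sets.

Set Implicit Arguments.
Unset Strict Implicit.
Unset Printing Implicit Defensive.

Record ugraph := Ugraph {
  vertex :> choiceType;
  adj : rel vertex;
  adj_sym : symmetric adj
}.

Section Walks.
Variable G : ugraph.
Implicit Types (s t r : seq G) (x y z : G).

(* A walk (v_0 v_1 ... v_n) is the nonempty sequence of its n.+1 vertices. *)
Definition is_walk s : bool := if s is x :: p then path (@adj G) x p else false.

Inductive walk_move : seq G -> seq G -> Prop :=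
| Spider s t x y y' z :
    is_walk (s ++ [:: x; y; z] ++ t) -> is_walk (s ++ [:: x; y'; z] ++ t) ->
    walk_move (s ++ [:: x; y; z] ++ t) (s ++ [:: x; y'; z] ++ t)
| Prune s t x y :
    is_walk (s ++ [:: x; y; x] ++ t) ->
    walk_move (s ++ [:: x; y; x] ++ t) (s ++ [:: x] ++ t)
| AntiPrune s t x y :
    is_walk (s ++ [:: x; y; x] ++ t) ->
    walk_move (s ++ [:: x] ++ t) (s ++ [:: x; y; x] ++ t).

Definition walk_equiv : seq G -> seq G -> Prop := clos_refl_trans _ walk_move.

(* Only meaningful when t starts at the last vertex of s: the shared vertex
   occurs once in the concatenated walk. *)
Definition walk_cat s t : seq G := s ++ behead t.

Definition is_closed_walk (v : G) s : bool :=
  [&& is_walk s, head v s == v & last v s == v].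

Lemma is_walk_cat s x t :
  is_walk (s ++ x :: t) = is_walk (rcons s x) && is_walk (x :: t).
Proof.
case: s => [|y s] /=; first by [].
by rewrite cat_path rcons_path /= andbA.
Qed.

Lemma is_walk_rev s : is_walk (rev s) = is_walk s.
Proof.
case: s => [|x s]; first by [].
rewrite (lastI x s) rev_rcons /= rev_path -lastI /=.
by apply: eq_path => y z; exact: adj_sym.
Qed.

Lemma walk_move_walk s t : walk_move s t -> is_walk s /\ is_walk t.
Proof.
case=> {s t} [s t x y y' z w1 w2|s t x y w|s t x y w] //.
- split=> //; move: w; rewrite /= is_walk_cat => /andP[w1 /and3P[_ _ w2]].
  by rewrite is_walk_cat w1.
- split=> //; move: w; rewrite /= is_walk_cat => /andP[w1 /and3P[_ _ w2]].
  by rewrite is_walk_cat w1.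
Qed.

Lemma walk_move_sym s t : walk_move s t -> walk_move t s.
Proof. by case=> *; [exact: Spider | exact: AntiPrune | exact: Prune]. Qed.

Lemma walk_move_ends v s t : walk_move s t ->
  head v s = head v t /\ last v s = last v t.
Proof. by case=> [[|? ?]|[|? ?]|[|? ?]] *; rewrite /= ?last_cat /= ?last_cat. Qed.

Lemma walk_move_catl r s t : is_walk (r ++ s) -> walk_move s t ->
  walk_move (r ++ s) (r ++ t).
Proof.
move=> ws m; have : is_walk (r ++ t).
  have [_] := walk_move_walk m; case: s m ws => [|x s] m ws.
    by have [] := walk_move_walk m.
  have [] := walk_move_ends x m; case: t m => [|y t] //= m <- _ wt.
  by move: ws; rewrite !is_walk_cat => /andP[-> _].
case: m ws => {s t} *.
- by rewrite !(catA r); apply: Spider; rewrite -catA.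
- by rewrite !(catA r); apply: Prune; rewrite -catA.
- by rewrite !(catA r); apply: AntiPrune; rewrite -catA.
Qed.

Lemma walk_move_rev s t : walk_move s t -> walk_move (rev s) (rev t).
Proof.
have E a p b : rev (a ++ p ++ b) = rev b ++ rev p ++ rev a.
  by rewrite !rev_cat catA.
case=> {s t} [s t x y y' z w1 w2|s t x y w|s t x y w].
- move: w1 w2; rewrite -is_walk_rev -[X in _ -> is_true X -> _]is_walk_rev !E.
  exact: Spider.
- by move: w; rewrite -is_walk_rev !E; exact: Prune.
- by move: w; rewrite -is_walk_rev !E; exact: AntiPrune.
Qed.

Lemma walk_equiv_sym s t : walk_equiv s t -> walk_equiv t s.
Proof.
elim=> [a b m|a|a b c _ IH1 _ IH2].
- exact/rt_step/walk_move_sym.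
- exact: rt_refl.
- exact: rt_trans IH2 IH1.
Qed.

Lemma walk_equiv_rev s t : walk_equiv s t -> walk_equiv (rev s) (rev t).
Proof.
elim=> [a b m|a|a b c _ IH1 _ IH2].
- exact/rt_step/walk_move_rev.
- exact: rt_refl.
- exact: rt_trans IH1 IH2.
Qed.

Lemma walk_equiv_catl r s t : is_walk (r ++ s) -> walk_equiv s t ->
  walk_equiv (r ++ s) (r ++ t) /\ is_walk (r ++ t).
Proof.
move=> ws e; elim: e ws => [a b m|a|a b c _ IH1 _ IH2] w.
- have m' := walk_move_catl w m.
  by split; [exact: rt_step | have [] := walk_move_walk m'].
- by split=> //; exact: rt_refl.
- have [e1 w1] := IH1 w; have [e2 w2] := IH2 w1.
  by split=> //; exact: rt_trans e1 e2.
Qed.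

Lemma walk_equiv_catr r s t : is_walk (s ++ r) -> walk_equiv s t ->
  walk_equiv (s ++ r) (t ++ r).
Proof.
move=> w /walk_equiv_rev e.
have w' : is_walk (rev r ++ rev s) by rewrite -rev_cat is_walk_rev.
have := walk_equiv_rev (walk_equiv_catl w' e).1.
by rewrite -!rev_cat !revK.
Qed.

Lemma walk_equiv_catV s x : is_walk (rcons s x) ->
  walk_equiv (rcons s x ++ rev s) (take 1 (rcons s x)).
Proof.
elim/last_ind: s x => [|s y IH] x w; first exact: rt_refl.
have w' : is_walk (rcons s y).
  by move: w; rewrite -cats1 cat_rcons is_walk_cat => /andP[].
have -> : take 1 (rcons (rcons s y) x) = take 1 (rcons s y).
  by case: (s) => [|? ?] //=; rewrite !take0.
apply: rt_trans (IH _ w').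
have -> : rcons (rcons s y) x ++ rev (rcons s y) = s ++ [:: y; x; y] ++ rev s.
  by rewrite rev_rcons -!cats1 -!catA.
rewrite cat_rcons; apply/rt_step/Prune.
rewrite -[_ ++ _]/(s ++ y :: x :: y :: rev s).
have e : adj y x by move: w; rewrite -cats1 cat_rcons is_walk_cat /= andbT => /andP[].
have wr : is_walk (y :: rev s) by rewrite -rev_rcons is_walk_rev.
by rewrite is_walk_cat w' /= e adj_sym e.
Qed.

End Walks.

Section FundamentalGroup.
Variables (G : ugraph) (v : G).

Record closed_walk := ClosedWalk {
  walk_seq :> seq G;
  closed_walkP : is_closed_walk v walk_seq
}.

HB.instance Definition _ := [isSub for walk_seq].
HB.instance Definition _ := [Choice of closed_walk by <:].

Implicit Types w : closed_walk.

Lemma closed_walk_cons w : exists p, walk_seq w = v :: p.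
Proof. by case: w => [[|x p] //= /and3P[_ /eqP/= -> _]]; exists p. Qed.

Lemma closed_walk_rcons w : exists p, walk_seq w = rcons p v.
Proof.
case: w => s /= /and3P[]; case/lastP: s => [|p x] // _ _.
by rewrite last_rcons => /eqP->; exists p.
Qed.

Lemma closed_walk_walk w : is_walk w.
Proof. by have /and3P[] := closed_walkP w. Qed.

Lemma triv_walk_subproof : is_closed_walk v [:: v].
Proof. by rewrite /is_closed_walk /= eqxx. Qed.
Definition triv_walk := ClosedWalk triv_walk_subproof.

Lemma cat_walk_subproof w1 w2 : is_closed_walk v (walk_cat w1 w2).
Proof.
have := closed_walkP w1; have := closed_walkP w2.
have [p ->] := closed_walk_cons w1; have [r ->] := closed_walk_cons w2.
rewrite /is_closed_walk /walk_cat /= last_cat cat_path.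
by move=> /and3P[p2 _ l2] /and3P[p1 -> /eqP l1]; rewrite p1 l1 p2.
Qed.
Definition cat_walk w1 w2 := ClosedWalk (cat_walk_subproof w1 w2).

Lemma inv_walk_subproof w : is_closed_walk v (rev w).
Proof.
rewrite /is_closed_walk is_walk_rev closed_walk_walk /=.
have [p e] := closed_walk_cons w; have [r e'] := closed_walk_rcons w.
by rewrite {1}e' e rev_rcons rev_cons last_rcons /= eqxx.
Qed.
Definition inv_walk w := ClosedWalk (inv_walk_subproof w).

Definition prod_walk (ws : seq closed_walk) := foldr cat_walk triv_walk ws.

Definition closed_walk_equiv : rel closed_walk :=
  fun w1 w2 => `[< walk_equiv w1 w2 >].

Lemma closed_walk_equiv_refl : reflexive closed_walk_equiv.
Proof. by move=> w; apply/asboolP/rt_refl. Qed.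
Lemma closed_walk_equiv_sym : symmetric closed_walk_equiv.
Proof. by move=> w1 w2; apply/asboolP/asboolP => /walk_equiv_sym. Qed.
Lemma closed_walk_equiv_trans : transitive closed_walk_equiv.
Proof.
move=> w2 w1 w3 /asboolP e1 /asboolP e2; apply/asboolP.
exact: rt_trans e1 e2.
Qed.

Canonical closed_walk_equiv_rel := EquivRel closed_walk_equiv
  closed_walk_equiv_refl closed_walk_equiv_sym closed_walk_equiv_trans.

Local Open Scope quotient_scope.

Definition Pi := {eq_quot closed_walk_equiv_rel}.
HB.instance Definition _ := Choice.on Pi.
HB.instance Definition _ := EqQuotient.on Pi.

Definition Pi_class (w : closed_walk) : Pi := \pi_Pi w.

Definition Pi_one : Pi := Pi_class triv_walk.
Definition Pi_mul (a b : Pi) : Pi := Pi_class (cat_walk (repr a) (repr b)).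
Definition Pi_inv (a : Pi) : Pi := Pi_class (inv_walk (repr a)).

Lemma Pi_classP w1 w2 : Pi_class w1 = Pi_class w2 <-> walk_equiv w1 w2.
Proof.
by split=> [/eqmodP/asboolP | e]; last exact/eqmodP/asboolP.
Qed.

Lemma Pi_reprK a : Pi_class (repr a) = a.
Proof. exact: reprK. Qed.

Lemma cat_walk_equiv w1 w1' w2 w2' : walk_equiv w1 w1' -> walk_equiv w2 w2' ->
  walk_equiv (cat_walk w1 w2) (cat_walk w1' w2').
Proof.
move=> e1 e2; rewrite /walk_equiv; apply: (@rt_trans _ _ _ (walk_seq (cat_walk w1' w2))).
  exact: walk_equiv_catr (closed_walk_walk (cat_walk w1 w2)) e1.
have w := closed_walk_walk (cat_walk w1' w2).
have [p e] := closed_walk_rcons w1'; move: w e2 => /=; rewrite /walk_cat e.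
have [r ->] := closed_walk_cons w2; have [r' ->] := closed_walk_cons w2'.
by rewrite !cat_rcons /= => w e2; exact: (walk_equiv_catl w e2).1.
Qed.

Lemma Pi_class_mul w1 w2 :
  Pi_class (cat_walk w1 w2) = Pi_mul (Pi_class w1) (Pi_class w2).
Proof. by apply/Pi_classP/cat_walk_equiv; apply/Pi_classP; rewrite Pi_reprK. Qed.

Lemma Pi_class_inv w : Pi_class (inv_walk w) = Pi_inv (Pi_class w).
Proof. by apply/Pi_classP/walk_equiv_rev/Pi_classP; rewrite Pi_reprK. Qed.

Lemma cat_walkA : associative cat_walk.
Proof.
move=> w1 w2 w3; apply: val_inj; rewrite /= /walk_cat.
by have [p ->] := closed_walk_cons w2; rewrite /= catA.
Qed.

Lemma cat_walk1 : right_id triv_walk cat_walk.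
Proof. by move=> w; apply: val_inj; rewrite /= /walk_cat cats0. Qed.

Lemma cat_1walk : left_id triv_walk cat_walk.
Proof.
by move=> w; apply: val_inj; have [p e] := closed_walk_cons w; rewrite /= e.
Qed.

Lemma Pi_mulA : associative Pi_mul.
Proof.
move=> a b c; rewrite -[a]Pi_reprK -[b]Pi_reprK -[c]Pi_reprK.
by rewrite -!Pi_class_mul cat_walkA.
Qed.

Lemma Pi_mul1 : right_id Pi_one Pi_mul.
Proof. by move=> a; rewrite -[a]Pi_reprK -Pi_class_mul cat_walk1. Qed.

Lemma Pi_1mul : left_id Pi_one Pi_mul.
Proof. by move=> a; rewrite -[a]Pi_reprK -Pi_class_mul cat_1walk. Qed.

Lemma cat_walkV w : walk_equiv (cat_walk w (inv_walk w)) triv_walk.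
Proof.
have := closed_walk_walk w; rewrite /= /walk_cat.
have [p' e'] := closed_walk_cons w; have [p e] := closed_walk_rcons w.
rewrite e => /walk_equiv_catV; rewrite -e e' /= take0 -e' e.
by rewrite rev_rcons.
Qed.

Lemma inv_walkK : involutive inv_walk.
Proof. by move=> w; apply: val_inj; rewrite /= revK. Qed.

Lemma Pi_mulV : right_inverse Pi_one Pi_inv Pi_mul.
Proof.
move=> a; rewrite -[a]Pi_reprK -Pi_class_inv -Pi_class_mul.
exact/Pi_classP/cat_walkV.
Qed.

Lemma Pi_Vmul : left_inverse Pi_one Pi_inv Pi_mul.
Proof.
move=> a; rewrite -[a]Pi_reprK -Pi_class_inv -Pi_class_mul.
by apply/Pi_classP; rewrite -{2}(inv_walkK (repr a)); exact: cat_walkV.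
Qed.

HB.instance Definition _ :=
  isGroup.Build Pi Pi_mulA Pi_1mul Pi_mul1 Pi_Vmul Pi_mulV.

End FundamentalGroup.

Local Open Scope classical_set_scope.

Definition generated_subgroup (gT : groupType) (A : set gT) : set gT :=
  smallest [set S : set gT | group_closed [in S]] A.

Section Hamming.
Variables d q : nat.

Definition hamming_adj : rel {ffun 'I_d -> 'I_q} :=
  fun x y => #|[set k | x k != y k]%SET| == 1.

Lemma hamming_adj_sym : symmetric hamming_adj.
Proof.
by move=> x y; rewrite /hamming_adj; under eq_finset do rewrite eq_sym.
Qed.

Definition hamming : ugraph := Ugraph hamming_adj_sym.

Variable hq : 0 < q.
Let zero : 'I_q := Ordinal hq.

Definition origin : hamming := [ffun => zero].

Definition axis_vertex (i : 'I_d) (a : 'I_q) : hamming :=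
  [ffun k => if k == i then a else zero].

Definition is_ground_walk (i : 'I_d) (w : closed_walk origin) : Prop :=
  exists a b : 'I_q, [/\ a != zero, b != zero, a != b &
    walk_seq w = [:: origin; axis_vertex i a; axis_vertex i b; origin]].

End Hamming.

(* Main.v *)
Require Import Defs.
From mathcomp Require Import all_boot.
From mathcomp Require Import boolp classical_sets.

Set Implicit Arguments.
Unset Strict Implicit.
Unset Printing Implicit Defensive.

(** Count, modulo 2, the steps of a walk that change the [i]-th coordinate.
    Every move preserves this parity.  For a prune or an anti-prune this is
    clear, since a step and its reverse change the same coordinate.  For a
    spider move, the contribution of two consecutive steps [x y z] is in fact
    a function of [x] and [z] alone ([flips_two_steps]).  Hence the parity
    induces a morphism from the fundamental group to Z/2.  It is odd on [U i],
    a triangle with three steps in direction [i], and even on [U j] for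
    [j != i], which never moves in direction [i]; so it is even on everything
    the latter walks generate. *)

Section FlipParity.
Variables d q : nat.
Variable i : 'I_d.
Local Notation G := (hamming d q).
Implicit Types (x y z : G) (s t : seq G).

Fixpoint flips_from x s : bool :=
  if s is y :: s' then (x i != y i) (+) flips_from y s' else false.

Definition flip_parity s : bool := if s is x :: p then flips_from x p else false.

Lemma flips_from_cat x s t :
  flips_from x (s ++ t) = flips_from x s (+) flips_from (last x s) t.
Proof. by elim: s x => [|y s IH] x //=; rewrite IH addbA. Qed.

Lemma flip_parity_cat s x t :
  flip_parity (s ++ x :: t) = flip_parity (rcons s x) (+) flip_parity (x :: t).
Proof.
by case: s => [|y s] //=; rewrite -cats1 !flips_from_cat /= addbF addbA.
Qed.

Lemma flip_parity_rev s : flip_parity (rev s) = flip_parity s.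
Proof.
elim: s => [|x [|y s] IH] //.
rewrite rev_cons -cats1 rev_cons cat_rcons flip_parity_cat -rev_cons IH /=.
by rewrite addbF addbC eq_sym.
Qed.

Lemma adj_changed x y : adj x y -> exists k, forall j, (x j != y j) = (j == k).
Proof.
case/cards1P=> k /setP e; exists k => j.
by have := e j; rewrite !inE.
Qed.

(** If both steps change the same coordinate [k], then [x] and [z] differ at
    most at [k], and both sides are even.  If they change distinct coordinates
    [k] and [l], then [x] and [z] differ exactly at [k] and [l], each of which
    was changed once. *)
Lemma flips_two_steps x y z : adj x y -> adj y z ->
  (x i != y i) (+) (y i != z i) = (x i != z i) && ~~ adj x z.
Proof.
move=> /adj_changed[k exy] /adj_changed[l eyz]; rewrite exy eyz.
have [ekl|nkl] := eqVneq k l.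
  rewrite -ekl in eyz *; rewrite addbb; apply/esym/negbTE/negP => /andP[xz].
  have off j : j != k -> x j = z j.
    move=> jk; have := exy j; have := eyz j.
    by rewrite (negbTE jk) => /negbFE/eqP-> /negbFE/eqP->.
  have ik : i = k by apply: contraNeq xz => /off->.
  case/negP; apply/cards1P; exists k; apply/setP=> j; rewrite !inE.
  by have [->|/off->] := eqVneq j k; rewrite -?ik ?xz ?eqxx.
have exz j : (x j != z j) = (j \in [set k; l]%SET).
  rewrite !inE; have := exy j; have := eyz j.
  have [->|jk] := eqVneq j k.
    by rewrite (negbTE nkl) => /negbFE/eqP<-.
  by move=> + /negbFE/eqP->.
have -> : adj x z = false.
  rewrite /= /hamming_adj; have -> : [set j | x j != z j]%SET = [set k; l]%SET.
    by apply/setP=> j; rewrite -exz inE.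
  by rewrite cards2 nkl.
rewrite andbT exz !inE; have [->|//] := eqVneq i k.
by rewrite (negbTE nkl).
Qed.

Lemma flip_parity_move s t : walk_move s t -> flip_parity s = flip_parity t.
Proof.
have adjs (u v : seq G) (x y z : G) :
    is_walk (u ++ [:: x; y; z] ++ v) -> adj x y /\ adj y z.
  by rewrite is_walk_cat => /andP[_] /and3P[].
have prune u v x y :
    flip_parity (u ++ [:: x; y; x] ++ v) = flip_parity (u ++ [:: x] ++ v).
  by rewrite !flip_parity_cat /= (eq_sym (y i)) addKb.
case=> {s t} [s t x y y' z|s t x y _|s t x y _]; last 2 first.
- exact: prune.
- exact/esym/prune.
move=> /adjs[xy yz] /adjs[xy' y'z]; rewrite !flip_parity_cat /= !(addbA (x i != _)).
by rewrite !flips_two_steps.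
Qed.

Lemma flip_parity_equiv s t : walk_equiv s t -> flip_parity s = flip_parity t.
Proof.
by elim=> [a b /flip_parity_move|//|a b c _ -> _ ->].
Qed.

Section Closed.
Variable v : G.
Implicit Types w : closed_walk v.

Lemma flip_parity_cat_walk w1 w2 :
  flip_parity (cat_walk w1 w2) = flip_parity w1 (+) flip_parity w2.
Proof.
rewrite /= /walk_cat.
have [p ->] := closed_walk_rcons w1; have [r ->] := closed_walk_cons w2.
by rewrite cat_rcons flip_parity_cat.
Qed.

Lemma flip_parity_prod_walk (ws : seq (closed_walk v)) :
  (forall w, w \in ws -> ~~ flip_parity w) -> ~~ flip_parity (prod_walk ws).
Proof.
elim: ws => [|w ws IH] //= even_ws.
rewrite -/(walk_seq (cat_walk w (prod_walk ws))) flip_parity_cat_walk.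
rewrite (negbTE (even_ws w (mem_head _ _))) /=.
by apply: IH => w' w'ws; apply: even_ws; rewrite inE w'ws orbT.
Qed.

Definition Pi_parity (a : Pi v) : bool := flip_parity (repr a).

Lemma Pi_parity_class w : Pi_parity (Pi_class w) = flip_parity w.
Proof. by apply: flip_parity_equiv; apply/Pi_classP; rewrite Pi_reprK. Qed.

Lemma Pi_parity_mul (a b : Pi v) :
  Pi_parity (a * b)%g = Pi_parity a (+) Pi_parity b.
Proof. by rewrite [LHS]Pi_parity_class flip_parity_cat_walk. Qed.

Lemma Pi_parity_inv (a : Pi v) : Pi_parity a^-1%g = Pi_parity a.
Proof. by rewrite [LHS]Pi_parity_class /= flip_parity_rev. Qed.

(** The kernel of the parity morphism is a subgroup, hence contains every
    subgroup generated by even classes. *)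
Lemma Pi_parity_generated (A : set (Pi v)) (a : Pi v) :
  (forall b, A b -> ~~ Pi_parity b) -> generated_subgroup A a -> ~~ Pi_parity a.
Proof.
move=> evenA; apply: (_ : generated_subgroup A `<=` [set b | ~~ Pi_parity b])%classic.
apply: smallest_sub => //=; split.
  by rewrite inE /= [Pi_parity _]Pi_parity_class.
move=> b c; rewrite !inE /= => evb evc.
by rewrite Pi_parity_mul Pi_parity_inv (negbTE evb).
Qed.

End Closed.

Lemma flip_parity_ground (hq : 0 < q) (j : 'I_d) (w : closed_walk (origin d hq)) :
  is_ground_walk j w -> flip_parity w = (i == j).
Proof.
case=> a [b [a0 b0 ab ->]]; rewrite /= !ffunE.
by case: (i == j); rewrite ?eqxx // (eq_sym _ a) a0 ab b0.
Qed.

End FlipParity.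

Theorem lemma4p7 (d q : nat) (hd : 0 < d) (hq : 0 < q)
    (U : 'I_d -> closed_walk (origin d hq))
    (hU : forall j : 'I_d, is_ground_walk j (U j)) (i : 'I_d) :
  (forall ws : seq (closed_walk (origin d hq)),
     (forall w, w \in ws ->
        exists j : 'I_d, j != i /\ (w = U j \/ w = inv_walk (U j))) ->
     ~ walk_equiv (U i) (prod_walk ws)) /\
  ~ generated_subgroup
      [set Pi_class (U j) | j in [set j : 'I_d | j != i]]%classic
      (Pi_class (U i)).
Proof.
have oddU : flip_parity i (U i) by rewrite (flip_parity_ground i (hU i)) eqxx.
have evenU j : j != i -> ~~ flip_parity i (U j).
  by rewrite (flip_parity_ground i (hU j)) eq_sym.
split=> [ws genws /(flip_parity_equiv i) e|].
  suff: ~~ flip_parity i (prod_walk ws) by rewrite -e oddU.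
  apply: flip_parity_prod_walk => w /genws[j [ji [->|->]]]; first exact: evenU.
  by rewrite /= flip_parity_rev evenU.
move=> gen; suff: ~~ Pi_parity i (Pi_class (U i)) by rewrite Pi_parity_class oddU.
by apply: Pi_parity_generated gen => _ [j ji <-]; rewrite Pi_parity_class evenU.
Qed.
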